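(* Let $m\ge 1$ and $N\ge 0$ be integers, let $C_n\in\mathbb{C}^{m\times m}$ for $0\le n\le 2N$, and let $$S(z)=\sum_{n=0}^{2N} C_n z^n ,\qquad z\in\mathbb{C}.$$ Suppose that $S(z)$ is positive definite for almost every $z\in\mathbb{R}$. Then there exist matrices $A_0,\dots,A_N\in\mathbb{C}^{m\times m}$ such that, with $$S^+(z)=\sum_{n=0}^{N}A_n z^n,\qquad S^-(z)=\overline{S^+(\overline{z})}^{\,T}=\sum_{n=0}^{N}A_n^* z^{n},$$ one has $$S(z)=S^+(z)S^-(z)\quad\text{for all } z\in\mathbb{C},$$ and $\det S^+(z)\neq 0$ for all $z$ with $\operatorname{Im} z>0$ (respectively, $S^-$ is nonsingular in the open lower half plane $\{z\in\mathbb{C}:\operatorname{Im} z<0\}$). Moreover, $S^+$ is unique up to a constant right unitary multiplier: if $S_1^+$ and $S_2^+$ are two matrix polynomials of this form with these properties, then there is a constant unitary matrix $U\in\mathbb{C}^{m\times m}$ such that $S_1^+(z)=S_2^+(z)U$ for all $z$.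
   Context: For a complex matrix $A$, $A^*=\overline{A}^{\,T}$ denotes its Hermitian conjugate (conjugate transpose). ''Positive definite'' means Hermitian positive definite, and ''almost every'' refers to Lebesgue measure on $\mathbb{R}$. A matrix function is nonsingular in a domain if its determinant has no zero there. *)

(* Defs.v *)
From mathcomp Require Import all_boot all_order all_algebra.
From mathcomp Require Import all_classical all_reals all_analysis.
From mathcomp Require Import complex.
Set Implicit Arguments.
Unset Strict Implicit.
Unset Printing Implicit Defensive.
Import Order.TTheory GRing.Theory Num.Theory.
Local Open Scope ring_scope.
Local Open Scope sesquilinear_scope.
Local Open Scope complex_scope.

Definition posdefmx (K : numClosedFieldType) (m : nat) (A : 'M[K]_m) : Prop :=
  A \is hermsymmx /\
  forall x : 'cV[K]_m, x != 0 -> 0 < (x ^t* *m A *m x) 0 0.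

Definition mxpoly_at (K : numClosedFieldType) (m d : nat)
    (A : 'I_d.+1 -> 'M[K]_m) (z : K) : 'M[K]_m :=
  \sum_(n < d.+1) z ^+ n *: A n.

(* The para-Hermitian conjugate: first evaluate at the conjugate point, then
   take the conjugate transpose, so that the result is again a polynomial in z
   (see mxpoly_paraE). *)
Definition mxpoly_para (K : numClosedFieldType) (m d : nat)
    (A : 'I_d.+1 -> 'M[K]_m) (z : K) : 'M[K]_m :=
  (mxpoly_at A z^*) ^t*.

Lemma mxpoly_paraE (K : numClosedFieldType) (m d : nat)
    (A : 'I_d.+1 -> 'M[K]_m) (z : K) :
  mxpoly_para A z = mxpoly_at (fun n => (A n) ^t*) z.
Proof.
apply/matrixP=> i j; rewrite /mxpoly_para /mxpoly_at !mxE !summxE rmorph_sum.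
by apply: eq_bigr => n _; rewrite !mxE rmorphM rmorphXn /= conjCK.
Qed.

Definition spectral_factor (R : realType) (m N : nat)
    (C : 'I_(2 * N).+1 -> 'M[R[i]]_m) (A : 'I_N.+1 -> 'M[R[i]]_m) : Prop :=
  [/\ forall z : R[i], mxpoly_at C z = mxpoly_at A z *m mxpoly_para A z,
      forall z : R[i], 0 < complex.Im z -> \det (mxpoly_at A z) != 0
    & forall z : R[i], complex.Im z < 0 -> \det (mxpoly_para A z) != 0].

(* Main.v *)
Require Import Defs.
From mathcomp Require Import all_boot all_order all_algebra.
From mathcomp Require Import all_classical all_reals all_analysis.
From mathcomp Require Import perm complex polyrcf zify.
Import Order.TTheory GRing.Theory Num.Theory.
Local Open Scope ring_scope.
Local Open Scope sesquilinear_scope.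
Local Open Scope complex_scope.
Set Implicit Arguments.
Unset Strict Implicit.
Unset Printing Implicit Defensive.

(** The coefficient family is turned into a matrix [H] over [{poly R[i]}], and
    [paraconj] is the para-Hermitian conjugation of such matrices, so that a
    spectral factor is a solution of [H = T *m paraconj T] whose determinant
    does not vanish in the open upper half plane ([factorable]).

    Existence proceeds by congruences [P *m H *m paraconj P], which preserve
    positive definiteness on a dense set of real points as long as the
    determinant of [P] is not zero.

    First, the zeros of [\det H] are removed. They are symmetric about the real
    axis, so if there is one, there is one, [a], in the closed lower half plane.
    A vector in the left kernel of [H(a)] can be made a row of a constant change
    of basis; in the new basis one row of [H] is divisible by [X - a], the
    corresponding column by the conjugate factor, and their common diagonal entry
    by the product of both. For real [a] the last point is where positivity
    enters: a nonnegative real polynomial only has zeros of even order. Dividing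
    that row and that column lowers the degree of the determinant by two, and the
    factor [X - a] has no zero in the upper half plane ([factorable_step]).

    Second, when [\det H] is constant, [H] is brought to a constant matrix by
    Hermite reduction ([degree_reduction]). Give the rows weights [d i] with
    [deg (H i j) <= d i + d j]. The matrix of the coefficients of degree
    [d i + d j] is singular as long as some weight is positive, because its
    determinant is the coefficient of [\det H] of degree [2 \sum_i d i]. A vector
    in its kernel yields a unimodular row operation that lowers one weight; on
    the diagonal the degree drops by two and not only by one, because a
    nonnegative real polynomial has even degree. A constant positive definite
    matrix is factored with the spectral theorem.

    The bound on the degree of the factor is automatic: in
    [H i i = \sum_j T i j * conj (T i j)] the leading terms cannot cancel
    ([size_sum_norm]).

    For uniqueness, [T2^-1 T1] is unitary on the real line, its denominators
    divide [\det T2] and also the determinant of [paraconj T1], so its poles are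
    real; a real pole is excluded by unitarity, and a polynomial matrix which is
    unitary on the real line is constant. In [common_quotient] this is done row by
    row without any limit, by dividing one root of [\det T2] at a time out of an
    identity between sums of squared norms. *)

(** * Nonnegative real polynomials *)

Section RealPoly.
Variable R : rcfType.
Implicit Types (f g : {poly R}).

Definition dense (D : R -> Prop) : Prop :=
  forall a b, a < b -> exists2 x, a < x < b & D x.

Lemma poly_ge0_adherent f x :
  (forall d, 0 < d -> exists2 y, `|y - x| < d & 0 <= f.[y]) -> 0 <= f.[x].
Proof.
move=> near_ge0; rewrite leNgt; apply/negP => fx_lt0.
have [|d /near_ge0[y /[swap] fy yd] dP] := poly_cont x f (e := - f.[x]).
  by rewrite oppr_gt0.
have := le_lt_trans (ler_norm _) (dP y yd).
by rewrite ltrBlDr addNr ltNge fy.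
Qed.

Lemma dense_poly_ge0 (D : R -> Prop) f :
  dense D -> (forall x, D x -> 0 <= f.[x]) -> forall x, 0 <= f.[x].
Proof.
move=> dD f_ge0 x; apply: poly_ge0_adherent => d d_gt0.
have [|y /andP[xy yd] /f_ge0 fy] := dD x (x + d); first by rewrite ltrDl.
by exists y => //; rewrite gtr0_norm ?subr_gt0// ltrBlDl.
Qed.

(** The quotient by [X - a] is nonnegative on the right of [a] and nonpositive on
    its left, hence vanishes at [a]. *)
Lemma poly_ge0_double_root f a :
  (forall x, 0 <= f.[x]) -> root f a -> ('X - a%:P) ^+ 2 %| f.
Proof.
move=> f_ge0 /factor_theorem[q qE]; rewrite qE expr2.
rewrite dvdp_mul2r ?polyXsubC_eq0// dvdp_XsubCl /root.
have qx x : 0 <= q.[x] * (x - a) by rewrite -hornerXsubC -hornerM -qE.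
have half d : 0 < d -> 0 < d / 2 :> R /\ `|d / 2| < d.
  move=> d0; rewrite gtr0_norm ?divr_gt0//.
  by rewrite ltr_pdivrMr// mulr_natr mulr2n ltrDl.
rewrite eq_le -oppr_ge0 -hornerN; apply/andP; split.
  apply: poly_ge0_adherent => d /half[h0 hd].
  exists (a - d / 2); first by rewrite addrAC subrr add0r normrN.
  have := qx (a - d / 2).
  by rewrite addrAC subrr add0r mulrN -mulNr pmulr_lge0// hornerN.
apply: poly_ge0_adherent => d /half[h0 hd].
exists (a + d / 2); first by rewrite addrAC subrr add0r.
by have := qx (a + d / 2); rewrite addrAC subrr add0r pmulr_lge0.
Qed.

Lemma poly_ge0_lead_coef f : (forall x, 0 <= f.[x]) -> 0 <= lead_coef f.
Proof.
move=> f_ge0; rewrite leNgt; apply/negP => lf.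
have [|n nP] := poly_pinfty_gt_lc (p := - f).
  by rewrite lead_coefN oppr_gt0.
have := nP n (lexx n); rewrite lead_coefN hornerN lerN2 => /(le_trans (f_ge0 n)).
by rewrite leNgt lf.
Qed.

(** The leading coefficients of [f(X)] and [f(-X)] are both nonnegative, which
    forces the degree, that is [(size f).-1], to be even. *)
Lemma poly_ge0_odd_size f : (forall x, 0 <= f.[x]) -> f != 0 -> odd (size f).
Proof.
move=> f_ge0 f_neq0; apply: contraT => ev.
have := @poly_ge0_lead_coef (f \Po - 'X).
rewrite lead_coef_comp ?size_polyN ?size_polyX// lead_coefN lead_coefX.
have sf : odd (size f).-1.
  by move: ev; rewrite -[size f]prednK ?size_poly_gt0//= negbK.
rewrite -signr_odd sf mulrN1.
have lf : 0 < lead_coef f.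
  by rewrite lt_def lead_coef_eq0 f_neq0 poly_ge0_lead_coef.
move=> H; exfalso; suff: 0 <= - lead_coef f by rewrite oppr_ge0 leNgt lf.
by apply: H => x; rewrite horner_comp.
Qed.
End RealPoly.

(** * Para-Hermitian conjugation and positive definite matrices *)

Section ParaConj.
Variable K : numClosedFieldType.

Notation conjp := (map_poly (@Num.conj K)).

Definition evalmx m n (z : K) (M : 'M[{poly K}]_(m, n)) : 'M[K]_(m, n) :=
  map_mx (horner_eval z) M.

Definition paraconj m n (M : 'M[{poly K}]_(m, n)) : 'M[{poly K}]_(n, m) :=
  map_mx conjp M^T.

Lemma conjpK : involutive conjp.
Proof.
by move=> p; rewrite -map_poly_comp map_poly_id// => x _; rewrite /= conjCK.
Qed.

Lemma horner_conjp p z : (conjp p).[z] = Num.conj p.[Num.conj z].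
Proof. by rewrite -{1}[z]conjCK horner_map. Qed.

Lemma evalmxM m n p z (A : 'M[{poly K}]_(m, n)) (B : 'M[{poly K}]_(n, p)) :
  evalmx z (A *m B) = evalmx z A *m evalmx z B.
Proof. exact: map_mxM. Qed.

Lemma det_evalmx n z (A : 'M[{poly K}]_n) : \det (evalmx z A) = (\det A).[z].
Proof. exact: det_map_mx. Qed.

Lemma evalmx_paraconj m n z (A : 'M[{poly K}]_(m, n)) :
  evalmx z (paraconj A) = (evalmx (Num.conj z) A)^t* .
Proof. by apply/matrixP => i j; rewrite !mxE /horner_eval horner_conjp. Qed.

Lemma paraconjM m n p (A : 'M[{poly K}]_(m, n)) (B : 'M[{poly K}]_(n, p)) :
  paraconj (A *m B) = paraconj B *m paraconj A.
Proof. by rewrite /paraconj trmx_mul map_mxM. Qed.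

Lemma paraconjK m n (A : 'M[{poly K}]_(m, n)) : paraconj (paraconj A) = A.
Proof. by apply/matrixP => i j; rewrite !mxE conjpK. Qed.

Lemma det_paraconj n (A : 'M[{poly K}]_n) : \det (paraconj A) = conjp (\det A).
Proof. by rewrite /paraconj det_map_mx det_tr. Qed.

Lemma posdefmx_congr m (P A : 'M[K]_m) :
  P \in unitmx -> posdefmx A -> posdefmx (P *m A *m P^t* ).
Proof.
move=> uP [/is_hermitianmxP]; rewrite expr0 scale1r => hA pA; split.
  apply/is_hermitianmxP; rewrite expr0 scale1r.
  by rewrite !trmx_mul !map_mxM/= trmxCK -hA mulmxA.
move=> x x0.
have := pA (P^t* *m x); rewrite trmx_mul map_mxM/= trmxCK !mulmxA; apply.
apply: contra_neq x0 => Px0.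
have uPt : P^t* \in unitmx by rewrite map_unitmx unitmx_tr.
by rewrite -[x](mulKmx uPt) Px0 mulmx0.
Qed.

Lemma posdefmx_congr_inv m (P A : 'M[K]_m) :
  P \in unitmx -> posdefmx (P *m A *m P^t* ) -> posdefmx A.
Proof.
move=> uP pA; have := posdefmx_congr (P := invmx P) _ pA.
rewrite unitmx_inv => /(_ uP); rewrite -!mulmxA mulKmx// -map_mxM -trmx_mul.
by rewrite mulVmx// trmx1 map_mx1 mulmx1.
Qed.

Lemma posdefmx_diag m (A : 'M[K]_m) k : posdefmx A -> 0 < A k k.
Proof.
move=> [_ /(_ (delta_mx k 0))].
have d0 : delta_mx k 0 != 0 :> 'cV[K]_m.
  by apply/eqP => /matrixP/(_ k 0)/eqP; rewrite !mxE !eqxx oner_eq0.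
move=> /(_ d0); rewrite trmx_delta map_delta_mx -rowE -colE.
by rewrite !mxE.
Qed.

Lemma posdefmx_det_neq0 m (A : 'M[K]_m) : posdefmx A -> \det A != 0.
Proof.
move=> [_ pA]; apply/det0P => -[v v0 vA].
have vt0 : v^t* != 0.
  by apply: contra_neq v0 => v0; rewrite -[v]trmxCK v0 trmx0 map_mx0.
by have := pA _ vt0; rewrite trmxCK vA mul0mx mxE ltxx.
Qed.

(** With [A] diagonalized by a unitary matrix, the square root is taken on the
    diagonal. *)
Lemma posdefmx_factor m (A : 'M[K]_m) :
  posdefmx A -> exists T : 'M[K]_m, A = T *m T^t* .
Proof.
move=> [hA pA].
have /orthomx_spectralP := hermitian_normalmx hA.
set P := spectralmx A; set d := spectral_diag A => AE.
have uP : P \is unitarymx := spectral_unitarymx A.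
have dA : diag_mx d = P *m A *m P^t* .
  rewrite AE (invmx_unitary uP) !mulmxA (unitarymxP uP) mul1mx -mulmxA.
  by rewrite (unitarymxP uP) mulmx1.
have pd : posdefmx (diag_mx d).
  by rewrite dA; apply: posdefmx_congr; rewrite ?unitarymx_unit.
exists (P^t* *m diag_mx (map_mx (fun a : K => sqrtC a) d)).
rewrite trmx_mul map_mxM/= trmxCK tr_diag_mx map_diag_mx mulmxA.
rewrite -(mulmxA (P^t* )) mulmx_diag {1}AE (invmx_unitary uP).
congr (_ *m diag_mx _ *m _); apply/rowP => j; rewrite !mxE.
have := posdefmx_diag j pd; rewrite !mxE eqxx mulr1n => d0.
rewrite /= (CrealP _) ?sqrtC_real// -?expr2 ?sqrtCK//.
exact: ltW.
Qed.
End ParaConj.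

(** * Complex polynomials on a dense set of real points *)

Section Dense.
Variable R : rcfType.
Implicit Types (D : R -> Prop) (p g : {poly R[i]}).
Local Notation conjp := (map_poly (@Num.conj _)).

Lemma dense_avoid_seq D (s : seq R) :
  dense D -> dense (fun x => D x /\ x \notin s).
Proof.
move=> dD; elim: s => [|u s IHs] a b ab.
  by have [x xab Dx] := dD a b ab; exists x.
have [|x /andP[x1 x2] [Dx xs]] := IHs a (if a < u < b then u else b).
  by case: ifP => // /andP[].
exists x.
  by move: x1 x2; case: ifP => [/andP[_ ub] -> /lt_trans->|_ -> ->].
split=> //; rewrite inE negb_or xs andbT.
case: ifP x2 => [_ /lt_eqF->//|uab xb].
by apply: contraFN uab => /eqP<-; rewrite x1.
Qed.

Lemma dense_avoid_roots D g :
  dense D -> g != 0 -> dense (fun x => D x /\ ~~ root g x%:C).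
Proof.
move=> dD g0 a b ab.
have [r gE] := closed_field_poly_normal g.
have [x xab [Dx xr]] := dense_avoid_seq (map (@complex.Re R) r) dD ab.
exists x => //; split=> //; rewrite gE rootZ ?lead_coef_eq0// root_prod_XsubC.
by apply: contra xr => /(map_f (@complex.Re R)).
Qed.

Lemma dense_poly_eq D p q :
  dense D -> (forall x, D x -> p.[x%:C] = q.[x%:C]) -> p = q.
Proof.
move=> dD pq; apply/eqP; rewrite -subr_eq0; apply/negPn/negP => pq0.
have [|x _ [/pq Dx]] := dense_avoid_roots dD pq0 (a := 0) (b := 1) => //.
by rewrite rootE hornerD hornerN Dx subrr eqxx.
Qed.

Lemma conj_real_complex (x : R) : Num.conj x%:C = x%:C.
Proof. exact: conjc_real. Qed.

Lemma dense_real_conjp D p :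
  dense D -> (forall x, D x -> p.[x%:C] \is Num.real) -> conjp p = p.
Proof.
move=> dD pr; apply: (dense_poly_eq dD) => x /pr/CrealP.
by rewrite horner_conjp conj_real_complex.
Qed.

(** This reduces complex polynomials to real ones: [p] and its conjugate agree on
    [D], hence everywhere. *)
Lemma dense_ge0_real_poly D p :
  dense D -> (forall x, D x -> 0 <= p.[x%:C]) ->
  exists2 f : {poly R}, p = map_poly (real_complex R) f & forall x, 0 <= f.[x].
Proof.
move=> dD p_ge0.
have pE := dense_real_conjp dD (fun x Dx => ger0_real (p_ge0 x Dx)).
pose f := \poly_(k < size p) complex.Re p`_k.
have fE : p = map_poly (real_complex R) f.
  apply/polyP => k; rewrite coef_map coef_poly /=; case: ltnP => [_|kp].
    by rewrite RRe_real//; apply/CrealP; rewrite -{2}pE coef_map.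
  by rewrite nth_default// rmorph0.
exists f => //; apply: (dense_poly_ge0 dD) => x /p_ge0.
by rewrite fE horner_map /= ler0c.
Qed.

Lemma dense_ge0_double_root D p (a : R) :
  dense D -> (forall x, D x -> 0 <= p.[x%:C]) -> root p a%:C ->
  ('X - (a%:C)%:P) ^+ 2 %| p.
Proof.
move=> dD /(dense_ge0_real_poly dD)[f -> f_ge0].
rewrite fmorph_root => /(poly_ge0_double_root f_ge0) h.
have <- : map_poly (real_complex R) (('X - a%:P) ^+ 2) = ('X - (a%:C)%:P) ^+ 2.
  by rewrite rmorphXn /= rmorphB /= map_polyX map_polyC.
by rewrite dvdp_map.
Qed.

Lemma dense_ge0_odd_size D p :
  dense D -> (forall x, D x -> 0 <= p.[x%:C]) -> p != 0 -> odd (size p).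
Proof.
move=> dD /(dense_ge0_real_poly dD)[f -> f_ge0].
by rewrite map_poly_eq0 size_map_poly; apply: poly_ge0_odd_size.
Qed.

(** Density is the form in which positivity survives all the reductions: dividing
    by a polynomial loses finitely many real points, and a dense set minus
    finitely many points is still dense. *)
Definition posdef_dense m (H : 'M[{poly R[i]}]_m) : Prop :=
  dense (fun x => posdefmx (evalmx x%:C H)).

Lemma evalmx_congr_real m (x : R) (P H : 'M[{poly R[i]}]_m) :
  evalmx x%:C (P *m H *m paraconj P) =
  evalmx x%:C P *m evalmx x%:C H *m (evalmx x%:C P)^t* .
Proof.
rewrite (evalmxM x%:C (P *m H)) (evalmxM x%:C P H) (evalmx_paraconj x%:C P).
by rewrite conj_real_complex.
Qed.

Lemma posdef_dense_congr m (P H : 'M[{poly R[i]}]_m) :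
  \det P != 0 -> posdef_dense H -> posdef_dense (P *m H *m paraconj P).
Proof.
move=> P0 dH a b ab; have [x xab [pH xP]] := dense_avoid_roots dH P0 ab.
exists x; first exact: xab.
rewrite evalmx_congr_real; apply: posdefmx_congr pH.
by rewrite unitmxE det_evalmx unitfE.
Qed.

Lemma posdef_dense_congr_inv m (P H : 'M[{poly R[i]}]_m) :
  \det P != 0 -> posdef_dense (P *m H *m paraconj P) -> posdef_dense H.
Proof.
move=> P0 dH a b ab; have [x xab [pH xP]] := dense_avoid_roots dH P0 ab.
exists x; first exact: xab.
move: pH; rewrite evalmx_congr_real; apply: posdefmx_congr_inv.
by rewrite unitmxE det_evalmx unitfE.
Qed.

Lemma posdef_dense_paraconj m (H : 'M[{poly R[i]}]_m) :
  posdef_dense H -> paraconj H = H.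
Proof.
move=> dH; apply/matrixP => i j; apply: (dense_poly_eq dH) => x [].
move=> /is_hermitianmxP; rewrite expr0 scale1r => /matrixP/(_ i j).
by rewrite !mxE /horner_eval horner_conjp conj_real_complex => ->.
Qed.

Lemma posdef_dense_diag m (H : 'M[{poly R[i]}]_m) k :
  posdef_dense H -> dense (fun x => 0 < (H k k).[x%:C]).
Proof.
move=> dH a b ab; have [x xab /(posdefmx_diag k)] := dH a b ab.
by rewrite mxE; exists x.
Qed.
End Dense.

(** * Row replacement and leading coefficients of determinants *)

Section Row.
Variable A : comNzRingType.

(** Multiplication on the left by this matrix replaces row [k] by the combination
    of the rows with coefficients [w], and keeps the other rows. *)
Definition row_subst m (k : 'I_m) (w : 'rV[A]_m) : 'M[A]_m :=
  \matrix_(i, j) if i == k then w 0 j else (i == j)%:R.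

(** The cofactors along row [k] do not see that row, so they are those of the
    identity matrix. *)
Lemma det_row_subst m (k : 'I_m) (w : 'rV[A]_m) : \det (row_subst k w) = w 0 k.
Proof.
have adj1 : \adj (1%:M : 'M[A]_m) = 1%:M by rewrite -[LHS]mul1mx mul_mx_adj det1.
rewrite (expand_det_row _ k) (bigD1 k)//= big1 => [|j jk].
  rewrite addr0 mxE eqxx -[RHS]mulr1; congr (_ * _).
  transitivity (\adj (1%:M : 'M[A]_m) k k); last by rewrite adj1 mxE eqxx.
  rewrite mxE.
  congr (_ * \det _); apply/matrixP => i j; rewrite !mxE.
  by rewrite eq_sym (negPf (neq_lift _ _)).
suff -> : cofactor (row_subst k w) k j = 0 by rewrite mulr0.
transitivity (\adj (1%:M : 'M[A]_m) j k); last by rewrite adj1 mxE (negPf jk).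
rewrite mxE.
congr (_ * \det _); apply/matrixP => i l; rewrite !mxE.
by rewrite eq_sym (negPf (neq_lift _ _)).
Qed.

Lemma row_substM m n (k : 'I_m) (w : 'rV[A]_m) (B : 'M[A]_(m, n)) i j :
  (row_subst k w *m B) i j = if i == k then (w *m B) 0 j else B i j.
Proof.
rewrite !mxE; case: ifP => ik.
  by apply: eq_bigr => l _; rewrite mxE ik.
rewrite (bigD1 i)//= mxE ik eqxx mul1r big1 ?addr0// => l li.
by rewrite mxE ik eq_sym (negPf li) mul0r.
Qed.
End Row.

Section Top.
Variable A : comNzRingType.
Implicit Types p q : {poly A}.

Lemma size_mul_top p q a b : (size p <= a.+1)%N -> (size q <= b.+1)%N ->
  (size (p * q)%R <= (a + b).+1)%N.
Proof.
move=> pa qb; apply: leq_trans (size_polyMleq _ _) _.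
by have := leq_add pa qb; lia.
Qed.

Lemma coef_mul_top p q a b : (size p <= a.+1)%N -> (size q <= b.+1)%N ->
  (p * q)`_(a + b) = p`_a * q`_b.
Proof.
move=> pa qb; have la : (a < (a + b).+1)%N by rewrite ltnS leq_addr.
rewrite coefM (bigD1 (Ordinal la))//= addKn big1 ?addr0// => -[j lj] /= ja.
have [aj|aj] := ltnP a j; first by rewrite nth_default ?mul0r// (leq_trans pa).
rewrite [q`_ _]nth_default ?mulr0// (leq_trans qb)//.
have {}ja : j != a by apply: contraNneq ja => ja; apply/eqP/val_inj.
by move: aj ja lj; lia.
Qed.

Lemma prod_top (I : Type) (s : seq I) (p : I -> {poly A}) (e : I -> nat) :
  (forall i, size (p i) <= (e i).+1)%N ->
  (size (\prod_(i <- s) p i)%R <= (\sum_(i <- s) e i).+1)%N /\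
  (\prod_(i <- s) p i)`_(\sum_(i <- s) e i) = \prod_(i <- s) (p i)`_(e i).
Proof.
move=> pe; elim: s => [|i s [IHs IHc]].
  by rewrite !big_nil size_poly1 coef1.
by rewrite !big_cons; split; [apply: size_mul_top|rewrite coef_mul_top// IHc].
Qed.

(** With the degree of [M i j] at most [d i + d j], every product in the Leibniz
    formula has degree at most twice the sum of the weights, and its coefficient
    there is the product of the coefficients of the factors. *)
Lemma coef_det_top m (M : 'M[{poly A}]_m) (d : 'I_m -> nat) :
  (forall i j, size (M i j) <= (d i + d j).+1)%N ->
  (\det M)`_(\sum_i (d i + d i)) = \det (\matrix_(i, j) (M i j)`_(d i + d j)).
Proof.
move=> Md; rewrite /determinant coef_sum; apply: eq_bigr => s _.
have -> : (\sum_i (d i + d i) = \sum_i (d i + d (s i)))%N.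
  rewrite !big_split /=; congr (_ + _)%N; exact: reindex_inj perm_inj.
have [_ H] := prod_top (index_enum 'I_m) (fun i => Md i (s i)).
transitivity ((-1) ^+ s * (\prod_i M i (s i))`_(\sum_i (d i + d (s i)))).
  by case: (odd_perm s); rewrite ?mul1r// expr1 !mulN1r coefN.
by rewrite H; congr (_ * _); apply: eq_bigr => i _; rewrite mxE.
Qed.

Lemma size_top_coef0 p n : (size p <= n.+1)%N -> p`_n = 0 -> (size p <= n)%N.
Proof.
move=> /leq_sizeP pn p0; apply/leq_sizeP => j.
by rewrite leq_eqVlt => /predU1P[<-//|/pn].
Qed.
End Top.

(** * Removing the zeros of the determinant *)

Section ZeroRemoval.
Variables (R : rcfType) (m : nat).
Local Notation C := R[i].
Local Notation conjp := (map_poly (@Num.conj _)).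
Implicit Types H P W : 'M[{poly C}]_m.

Definition nonvanishing_upper (p : {poly C}) : Prop :=
  forall z : C, 0 < complex.Im z -> p.[z] != 0.

Definition factorable H : Prop :=
  exists2 T : 'M[{poly C}]_m, H = T *m paraconj T & nonvanishing_upper (\det T).

Lemma factorable_congr P H :
  nonvanishing_upper (\det P) -> factorable H ->
  factorable (P *m H *m paraconj P).
Proof.
move=> uP [T -> uT]; exists (P *m T); first by rewrite paraconjM !mulmxA.
by move=> z z0; rewrite det_mulmx hornerM mulf_neq0 ?uP ?uT.
Qed.

Lemma unit_poly_nonvanishing (p : {poly C}) :
  p \is a GRing.unit -> nonvanishing_upper p.
Proof.
rewrite poly_unitE => /andP[/size_poly1P[c c0 ->] _] z _.
by rewrite hornerC.
Qed.

Lemma factorable_congr_inv P H :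
  P \in unitmx -> factorable (P *m H *m paraconj P) -> factorable H.
Proof.
move=> uP /(factorable_congr (P := invmx P)).
rewrite -!mulmxA mulKmx// -paraconjM mulVmx//.
have -> : paraconj 1%:M = 1%:M :> 'M[{poly C}]_m.
  by rewrite /paraconj trmx1 map_mx1.
rewrite mulmx1; apply.
by apply: unit_poly_nonvanishing; rewrite -unitmxE unitmx_inv.
Qed.

Lemma row_subst_unitmx k (w : 'rV[{poly C}]_m) (c : C) :
  w 0 k = c%:P -> c != 0 -> row_subst k w \in unitmx.
Proof.
move=> wk c0; rewrite unitmxE det_row_subst wk poly_unitE size_polyC c0 /=.
by rewrite coefC eqxx unitfE.
Qed.

Lemma unitmx_det_neq0 P : P \in unitmx -> \det P != 0.
Proof. by rewrite unitmxE; apply: contraTneq => ->; rewrite unitr0. Qed.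

Lemma posdef_dense_det_neq0 H : posdef_dense H -> \det H != 0.
Proof.
move=> dH; have [//|x _ /posdefmx_det_neq0] := dH 0 1.
by apply: contra_neq => d0; rewrite det_evalmx d0 horner0.
Qed.

(** Off the real axis the two factors are coprime, and both divide the entry
    because it has real coefficients. On the real axis they coincide, and
    positivity makes the zero double. *)
Lemma posdef_dense_para_dvd_diag H (k : 'I_m) (a : C) :
  posdef_dense H -> root (H k k) a ->
  ('X - a%:P) * ('X - (Num.conj a)%:P) %| H k k.
Proof.
move=> dH ra; have dHk := posdef_dense_diag k dH.
have [aR|aNR] := boolP (a \is Num.real).
  rewrite (CrealP aR) -expr2 -(RRe_real aR).
  by apply: (dense_ge0_double_root dHk) => [x /ltW//|]; rewrite RRe_real.
have rb : root (H k k) (Num.conj a).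
  have /matrixP/(_ k k) := posdef_dense_paraconj dH; rewrite !mxE => <-.
  by rewrite rootE horner_conjp conjCK (rootP ra) rmorph0.
have /factor_theorem[q qE] := ra; move: rb; rewrite qE rootM root_XsubC.
case/orP => [/factor_theorem[r ->]|/eqP/CrealP]; last by rewrite (negPf aNR).
by rewrite -mulrA [_ * ('X - a%:P)]mulrC dvdp_mulIr.
Qed.

(** [W] puts a left null vector of [H(a)] in row [k]; then row [k] of the congruent
    matrix vanishes at [a], column [k] at the conjugate of [a], and [D] is the
    diagonal matrix with [X - a] in position [k] and ones elsewhere. *)
Lemma root_congr_factor H (a : C) :
  posdef_dense H -> root (\det H) a ->
  exists W D H' : 'M[{poly C}]_m,
    [/\ W \in unitmx, W *m H *m paraconj W = D *m H' *m paraconj D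
      & \det D = 'X - a%:P].
Proof.
move=> dH ra.
have : \det (evalmx a H) == 0 by rewrite det_evalmx.
move=> /det0P[v /rV0Pn[k vk] vH].
pose w : 'rV[{poly C}]_m := map_mx polyC v.
pose W := row_subst k w.
have uW : W \in unitmx by apply: (row_subst_unitmx (c := v 0 k)); rewrite ?mxE.
pose H1 := W *m H *m paraconj W.
have dH1 : posdef_dense H1.
  by apply: posdef_dense_congr dH; exact: unitmx_det_neq0.
have H1k j : root (H1 k j) a.
  have -> : (H1 k j) = (w *m H *m paraconj W) 0 j.
    by rewrite /H1 -mulmxA row_substM eqxx mulmxA.
  have : evalmx a (w *m H *m paraconj W) 0 j = 0.
    rewrite !evalmxM.
    have -> : evalmx a w = v.
      by apply/rowP => l; rewrite !mxE /horner_eval hornerC.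
    by rewrite vH mul0mx mxE.
  by rewrite mxE /horner_eval rootE => ->.
have H1herm i j : H1 i j = conjp (H1 j i).
  by have /matrixP/(_ i j) := posdef_dense_paraconj dH1; rewrite !mxE.
pose l := 'X - a%:P; pose lc := 'X - (Num.conj a)%:P.
have lcE : conjp l = lc by rewrite rmorphB /= map_polyX map_polyC.
pose q j := H1 k j %/ l.
have qE j : H1 k j = l * q j by rewrite mulrC divpK// dvdp_XsubCl.
pose r := H1 k k %/ (l * lc).
have rE : H1 k k = l * r * lc.
  by rewrite mulrAC mulrC divpK//; exact: posdef_dense_para_dvd_diag.
pose H2 := \matrix_(i, j) if i == k then (if j == k then r else q j)
                          else if j == k then conjp (q i) else H1 i j.
pose d : 'rV[{poly C}]_m := \row_j if j == k then l else 1.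
exists W, (diag_mx d), H2; split=> //; last first.
  rewrite det_diag (bigD1 k)//= big1 => [|j jk]; rewrite !mxE ?eqxx ?mulr1//.
  by rewrite (negPf jk).
apply/matrixP => i j.
have -> : paraconj (diag_mx d) = diag_mx (map_mx conjp d).
  by rewrite /paraconj tr_diag_mx map_diag_mx.
rewrite mul_mx_diag mxE mul_diag_mx mxE [map_mx _ _ _ _]mxE -/H1.
rewrite [d 0 i]mxE [d 0 j]mxE [H2 i j]mxE.
have [->|ik] := eqVneq i k; have [->|jk] := eqVneq j k.
- by rewrite lcE rE.
- by rewrite rmorph1 mulr1 qE.
- by rewrite mul1r H1herm qE rmorphM mulrC.
- by rewrite mul1r rmorph1 mulr1.
Qed.

(** Only a zero in the closed lower half plane may be put into the factor: [X - a]
    then stays nonzero in the upper one. *)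
Lemma factorable_step H (a : C) :
  posdef_dense H -> root (\det H) a -> complex.Im a <= 0 ->
  exists H', [/\ posdef_dense H', (size (\det H') < size (\det H))%N
               & factorable H' -> factorable H].
Proof.
move=> dH ra a0; have [W [D [H' [uW WHE dD]]]] := root_congr_factor dH ra.
have D0 : \det D != 0 by rewrite dD polyXsubC_eq0.
have dH' : posdef_dense H'.
  apply: posdef_dense_congr_inv D0 _; rewrite -WHE.
  by apply: posdef_dense_congr; rewrite ?unitmx_det_neq0.
exists H'; split=> //.
  have /(congr1 (fun M : 'M[{poly C}]_m => size (\det M))) := WHE.
  have H'0 := posdef_dense_det_neq0 dH'; have H0 := posdef_dense_det_neq0 dH.
  have W0 := unitmx_det_neq0 uW.
  rewrite !det_mulmx !det_paraconj dD.
  have : size (\det W) = 1%N.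
    by move: uW; rewrite unitmxE poly_unitE => /andP[/eqP].
  rewrite !size_mul ?mulf_neq0 ?map_poly_eq0 ?polyXsubC_eq0//.
  rewrite !size_map_poly !size_XsubC => ->.
  by rewrite add1n add2n /= addn1 addn2 /= => ->.
move=> fH'; apply: (factorable_congr_inv uW); rewrite WHE.
apply: factorable_congr fH' => z z0; rewrite dD hornerXsubC subr_eq0.
by apply: contraTneq z0 => ->; rewrite -leNgt.
Qed.

(** [\det H] is its own conjugate, so its roots come in conjugate pairs. *)
Lemma lower_root H :
  posdef_dense H -> (1 < size (\det H))%N ->
  exists2 a, root (\det H) a & complex.Im a <= 0.
Proof.
move=> dH s1; have /closed_rootP[b rb] : size (\det H) != 1%N by rewrite gtn_eqF.
have [b0|b0] := leP (complex.Im b) 0; first by exists b.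
exists (Num.conj b); last by case: b b0 {rb} => x y /=; rewrite oppr_le0 => /ltW.
rewrite -(posdef_dense_paraconj dH) det_paraconj rootE horner_conjp conjCK.
by rewrite (rootP rb) rmorph0.
Qed.
End ZeroRemoval.

(** * Reduction of a unimodular matrix to a constant one *)

Section Unimodular.
Variables (R : rcfType) (m : nat).
Local Notation C := R[i].
Local Notation conjp := (map_poly (@Num.conj _)).
Implicit Types H P W : 'M[{poly C}]_m.

Lemma factorable_const H :
  posdef_dense H -> (forall i j, size (H i j) <= 1)%N -> factorable H.
Proof.
move=> dH H1.
pose A : 'M[C]_m := \matrix_(i, j) (H i j)`_0.
have HE : H = map_mx polyC A.
  by apply/matrixP => i j; rewrite !mxE -size1_polyC.
have evA z : evalmx z H = A.
  by apply/matrixP => i j; rewrite HE !mxE /horner_eval hornerC.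
have [//|x _] := dH 0 1; rewrite evA => pA.
have [T TE] := posdefmx_factor pA.
exists (map_mx polyC T).
  rewrite HE TE map_mxM; congr (_ *m _).
  by apply/matrixP => i j; rewrite !mxE map_polyC.
move=> z _; rewrite det_map_mx hornerC.
have := posdefmx_det_neq0 pA; rewrite TE det_mulmx.
by apply: contraNneq => ->; rewrite mul0r.
Qed.

Definition degree_bound (d : 'I_m -> nat) H : Prop :=
  forall i j, (size (H i j) <= (d i + d j).+1)%N.

(** The determinant of the matrix of leading coefficients is a coefficient of
    positive degree of the constant polynomial [\det H]. *)
Lemma leading_kernel (d : 'I_m -> nat) H :
  degree_bound d H -> (size (\det H) <= 1)%N -> (0 < \sum_i d i)%N ->
  exists2 c : 'rV[C]_m, c != 0 &
    forall j, \sum_i c 0 i * (H i j)`_(d i + d j) = 0.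
Proof.
move=> dH s1 d0.
pose L := \matrix_(i, j) (H i j)`_(d i + d j).
have : \det L == 0.
  rewrite -coef_det_top// nth_default// (leq_trans s1)// big_split /=.
  by rewrite addn_gt0 d0.
move=> /det0P[c c0 cL]; exists c => // j.
transitivity ((c *m L) 0 j); last by rewrite cL mxE.
by rewrite mxE; apply: eq_bigr => i _; rewrite mxE.
Qed.

(** One step of Hermite reduction. The vector [c] is a left null vector of the
    matrix of leading coefficients, and [k] has the largest weight among the
    indices with [c 0 i != 0]. Row [k] is replaced by the sum of the rows with
    coefficients [c i X^(d k - d i)]: these monomials align the degrees of all
    rows with that of row [k], and then the leading terms cancel. *)
Lemma degree_reduction (d : 'I_m -> nat) H :
  posdef_dense H -> degree_bound d H -> (size (\det H) <= 1)%N ->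
  (0 < \sum_i d i)%N ->
  exists P d', [/\ P \in unitmx, degree_bound d' (P *m H *m paraconj P)
                 & (\sum_i d' i < \sum_i d i)%N].
Proof.
move=> dH bH s1 d0.
have [c /rV0Pn[i0 ci0] cL] := leading_kernel bH s1 d0.
have [k ck kmax] := @arg_maxnP _ i0 (fun i => c 0 i != 0) d ci0.
(* Where the natural subtraction truncates, [c 0 i] is zero. *)
pose w : 'rV[{poly C}]_m := \row_i (c 0 i *: 'X^(d k - d i)).
pose P := row_subst k w.
have uP : P \in unitmx.
  by apply: (row_subst_unitmx (c := c 0 k)); rewrite // mxE subnn alg_polyC.
have P0 := unitmx_det_neq0 uP.
pose G := w *m H; pose H' := P *m H *m paraconj P.
have dH' : posdef_dense H' by exact: posdef_dense_congr.
have wH i j : (size (w 0 i * H i j)%R <= (d k + d j).+1)%N /\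
              (w 0 i * H i j)`_(d k + d j) = c 0 i * (H i j)`_(d i + d j).
  rewrite mxE; have [->|ci] := eqVneq (c 0 i) 0.
    by rewrite scale0r mul0r size_poly0 coef0 mul0r.
  have dik : (d i <= d k)%N := kmax i ci.
  have e : (d k + d j = (d k - d i) + (d i + d j))%N by rewrite addnA subnK.
  have sX : (size (c 0%R i *: 'X^(d k - d i))%R <= (d k - d i).+1)%N.
    by rewrite (leq_trans (size_scale_leq _ _))// size_polyXn.
  rewrite e; split; first exact: size_mul_top.
  by rewrite coef_mul_top// coefZ coefXn eqxx mulr1.
(* Row [k] of [P *m H] has lost its leading terms. *)
have GE j : (size (G 0%R j) <= d k + d j)%N.
  rewrite mxE; apply: size_top_coef0.
    apply: (leq_trans (size_sum _ _ _)); apply/bigmax_leqP => i _.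
    by have [] := wH i j.
  by rewrite coef_sum -[RHS](cL j); apply: eq_bigr => i _; have [] := wH i j.
have H'E i j : H' i j = if j == k then conjp ((w *m paraconj (P *m H)) 0 i)
                         else (P *m H) i j.
  rewrite -[H']paraconjK paraconjM paraconjK mxE [_^T i j]mxE row_substM.
  by case: ifP => // _; rewrite !mxE conjpK.
have H'k j : j != k -> H' k j = G 0 j.
  by move=> jk; rewrite H'E (negPf jk) row_substM eqxx.
have H'kk : (size (H' k k) <= d k + d k)%N.
  rewrite H'E eqxx size_map_poly mxE; apply: (leq_trans (size_sum _ _ _)).
  apply/bigmax_leqP => i _; rewrite [paraconj _ _ _]mxE [_^T _ _]mxE.
  rewrite row_substM eqxx mxE.
  have [->|ci] := eqVneq (c 0 i) 0; first by rewrite scale0r mul0r size_poly0.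
  have dik : (d i <= d k)%N := kmax i ci.
  have sX : (size (c 0%R i *: 'X^(d k - d i))%R <= (d k - d i).+1)%N.
    by rewrite (leq_trans (size_scale_leq _ _))// size_polyXn.
  apply: (leq_trans (size_polyMleq _ _)); rewrite size_map_poly.
  have size_bound (a b e f : nat) :
    (a <= (e - f).+1 -> f <= e -> b <= e + f -> (a + b).-1 <= e + e)%N by lia.
  exact: size_bound sX dik (GE i).
have H'odd : odd (size (H' k k)).
  have dkk := posdef_dense_diag k dH'.
  apply: (dense_ge0_odd_size dkk) => [x /ltW//|].
  have [//|x _] := dkk 0 1; apply: contraTneq => ->.
  by rewrite horner0 ltxx.
have dk0 : (0 < d k)%N.
  rewrite lt0n; apply: contraTneq H'odd => dk0.
  by move: H'kk; rewrite dk0 addn0 leqn0 => /eqP->.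
(* The degree of the diagonal entry is even and less than [2 d k]. *)
have H'kk1 : (size (H' k k) <= ((d k).-1 + (d k).-1).+1)%N.
  by move: H'kk H'odd dk0; lia.
pose d' i := if i == k then (d k).-1 else d i.
have H'kj j : j != k -> (size (H' k j) <= ((d k).-1 + d j).+1)%N.
  by move=> jk; rewrite H'k// -addSn prednK//; exact: GE.
exists P, d'; split=> // [i j|]; last first.
  rewrite (bigD1 k)//= [ltnRHS](bigD1 k)//= {1}/d' eqxx.
  rewrite (eq_bigr d); first by rewrite ltn_add2r ltn_predL.
  by move=> i ik; rewrite /d' (negPf ik).
rewrite /d' -/H'; have [->|ik] := eqVneq i k; have [->|jk] := eqVneq j k => //.
- exact: H'kj.
- have -> : H' i k = conjp (H' k i).
    by rewrite -{1}(posdef_dense_paraconj dH') mxE [_^T _ _]mxE.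
  by rewrite size_map_poly addnC; exact: H'kj.
- by rewrite H'E (negPf jk) row_substM (negPf ik).
Qed.

Lemma factorable_unimodular_bounded (d : 'I_m -> nat) H :
  degree_bound d H -> posdef_dense H -> (size (\det H) <= 1)%N -> factorable H.
Proof.
have [n] := ubnP (\sum_i d i)%N; elim: n => // n IHn in d H *.
rewrite ltnS => dn bd dH s1.
have [z0|p0] := posnP (\sum_i d i)%N.
  have d00 i : d i = 0%N.
    by apply/eqP; move/eqP: z0; rewrite sum_nat_eq0 => /forallP/(_ i).
  by apply: factorable_const => // i j; have := bd i j; rewrite !d00.
have [P [d' [uP bd' lt_d']]] := degree_reduction dH bd s1 p0.
apply: (factorable_congr_inv uP); apply: (IHn d').
- exact: leq_trans lt_d' dn.
- exact: bd'.
- by apply: posdef_dense_congr; [exact: unitmx_det_neq0|exact: dH].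
rewrite !det_mulmx det_paraconj.
move: uP; rewrite unitmxE poly_unitE => /andP[/size_poly1P[c c0 ->] _].
rewrite map_polyC mulrC mul_polyC (leq_trans (size_scale_leq _ _))//.
by rewrite mul_polyC (leq_trans (size_scale_leq _ _)).
Qed.

Lemma factorable_unimodular H :
  posdef_dense H -> (size (\det H) <= 1)%N -> factorable H.
Proof.
pose d (_ : 'I_m) := (\max_i \max_j size (H i j))%N.
apply: (factorable_unimodular_bounded (d := d)) => i j.
rewrite leqW// (leq_trans _ (leq_addr _ _))//.
apply: leq_trans (leq_bigmax i).
exact: (leq_bigmax (F := fun j => size (H i j)) j).
Qed.

Theorem posdef_dense_factorable H : posdef_dense H -> factorable H.
Proof.
have [n] := ubnP (size (\det H)); elim: n => // n IHn in H *.
rewrite ltnS => sn dH.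
have [s1|s1] := leqP (size (\det H)) 1; first exact: factorable_unimodular.
have [a ra a0] := lower_root dH s1.
have [H' [dH' lt_s fH]] := factorable_step dH ra a0.
by apply/fH/IHn => //; exact: leq_trans lt_s sn.
Qed.
End Unimodular.

(** * Uniqueness *)

Section Uniqueness.
Variable R : rcfType.
Local Notation C := R[i].
Local Notation conjp := (map_poly (@Num.conj _)).

(** At the largest degree [e'] of the [p j], the coefficient of degree [2 e'] of the
    sum is a sum of squared norms, not all zero. *)
Lemma size_sum_norm (I : finType) (p : I -> {poly C}) n :
  (size (\sum_j p j * conjp (p j))%R <= (n + n).+1)%N ->
  forall j, (size (p j) <= n.+1)%N.
Proof.
move=> sn j; pose e := (\max_j size (p j))%N.
have pe l : (size (p l) <= e)%N by exact: (leq_bigmax (F := fun l => size (p l))).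
apply: (leq_trans (pe j)); rewrite leqNgt; apply/negP => ne.
case eE : e => [|e'] in pe ne; first by move: ne; rewrite ltn0.
have coef0 : \sum_l (p l)`_e' * Num.conj (p l)`_e' = 0.
  transitivity (\sum_l p l * conjp (p l))`_(e' + e'); last first.
    rewrite nth_default// (leq_trans sn)//.
    by rewrite -addSn leq_add// ltnW.
  rewrite coef_sum; apply: eq_bigr => l _.
  by rewrite coef_mul_top ?size_map_poly// coef_map.
have pe0 l : (p l)`_e' = 0.
  have /(_ l isT)/eqP := psumr_eq0P (fun l _ => mul_conjC_ge0 (p l)`_e') coef0.
  by rewrite mul_conjC_eq0 => /eqP.
have : (e <= e')%N.
  by apply/bigmax_leqP => l _; apply: size_top_coef0.
by rewrite eE ltnn.
Qed.

(** The functions [V j / q = V' j / r] have their poles in the closed lower half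
    plane on account of [q], and in the closed upper one on account of [r]; and
    the sum of their squared norms is one on the real line. So a root of [q] is a
    root of every [V j]: for a root below the real axis by the first identity, for
    a real root by the second. Dividing by it preserves both identities. Once [q]
    is constant, the second identity makes the [V j] constant. *)
Lemma common_quotient (I : finType) (V V' : I -> {poly C}) (q r : {poly C}) :
  q != 0 -> (forall z, 0 < complex.Im z -> q.[z] != 0) ->
  (forall z, complex.Im z < 0 -> r.[z] != 0) ->
  (forall j, V j * r = q * V' j) ->
  \sum_j V j * conjp (V j) = q * conjp q ->
  exists c : I -> C, forall j, V j = c j *: q.
Proof.
have [n] := ubnP (size q); elim: n => // n IHn in V q *.
rewrite ltnS => qn q0 qup rlow VE sumV.
have [s1|s1] := eqVneq (size q) 1%N.
  move/eqP: s1 => /size_poly1P[a a0 qE].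
  exists (fun j => (V j)`_0 / a) => j.
  have : (size (V j) <= 1)%N.
    apply: (size_sum_norm (p := V) (n := 0)); rewrite sumV qE map_polyC -polyCM.
    exact: size_polyC_leq1.
  by move=> /size1_polyC->; rewrite qE -mul_polyC -polyCM coefC eqxx mulfVK.
have /closed_rootP[z rz] := s1.
have Vz j : root (V j) z.
  have [zlow|zup|z0] := ltgtP (complex.Im z) 0.
  - have := congr1 (horner^~ z) (VE j); rewrite !hornerM (rootP rz) mul0r.
    by move/eqP; rewrite mulf_eq0 (negPf (rlow z zlow)) orbF.
  - by have := qup z zup; rewrite (rootP rz) eqxx.
  have zr : Num.conj z = z.
    by apply/CrealP; case: z z0 {rz} => x y /= ->; rewrite complex_real.
  have sum0 : \sum_l (V l).[z] * Num.conj (V l).[z] = 0.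
    transitivity (\sum_l V l * conjp (V l)).[z].
      rewrite horner_sum; apply: eq_bigr => l _.
      by rewrite hornerM horner_conjp zr.
    by rewrite sumV hornerM (rootP rz) mul0r.
  have /(_ j isT)/eqP := psumr_eq0P (fun l _ => mul_conjC_ge0 (V l).[z]) sum0.
  by rewrite mul_conjC_eq0.
have l0 : 'X - z%:P != 0 by rewrite polyXsubC_eq0.
pose div (p : {poly C}) := p %/ ('X - z%:P).
have VD j : V j = div (V j) * ('X - z%:P) by rewrite divpK// dvdp_XsubCl.
have qD : q = div q * ('X - z%:P) by rewrite divpK// dvdp_XsubCl.
have dq0 : div q != 0 by apply: contra_neq q0 => dq; rewrite qD dq mul0r.
have [|w zw|j||c cP] := IHn (fun j => div (V j)) (div q) _ dq0 _ rlow.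
- move: qn; rewrite {1}qD size_mul// size_XsubC addn2 /=; exact: leq_trans.
- by have := qup w zw; rewrite {1}qD hornerM mulf_eq0 negb_or => /andP[].
- by apply: (mulIf l0); rewrite mulrAC -VD VE {1}qD mulrAC.
- have ll0 : ('X - z%:P) * conjp ('X - z%:P) != 0.
    by rewrite mulf_neq0 ?map_poly_eq0.
  apply: (mulIf ll0); rewrite mulr_suml mulrACA -rmorphM -qD -sumV.
  by apply: eq_bigr => j _; rewrite mulrACA -rmorphM -VD.
by exists c => j; rewrite VD cP -scalerAl -qD.
Qed.

(** [V = \det T2 *: T2^-1 *m T1]. Both identities required by [common_quotient] come
    from [T1 *m paraconj T1 = T2 *m paraconj T2], the first because
    [T2^-1 *m T1 = paraconj T2 *m (paraconj T1)^-1]. *)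
Lemma factor_unique m (T1 T2 : 'M[{poly C}]_m) :
  T1 *m paraconj T1 = T2 *m paraconj T2 ->
  nonvanishing_upper (\det T1) -> nonvanishing_upper (\det T2) ->
  exists2 U : 'M[C]_m, U \is unitarymx & T1 = T2 *m map_mx polyC U.
Proof.
move=> T12 u1 u2.
set q := \det T2; set r := \det (paraconj T1).
have q0 : q != 0.
  have := u2 'i%C ltr01; apply: contra_neq => qz.
  by rewrite -/q qz horner0.
have rlow z : complex.Im z < 0 -> r.[z] != 0.
  move=> z0; rewrite /r det_paraconj horner_conjp conjC_eq0 u1//.
  by case: z z0 => x y /=; rewrite oppr_gt0.
pose V := \adj T2 *m T1.
have VV : V *m paraconj V = (q * conjp q)%:M.
  rewrite paraconjM mulmxA -(mulmxA _ T1) T12 !mulmxA mul_adj_mx -/q -mulmxA.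
  rewrite -paraconjM mul_adj_mx -/q scalar_mxM; congr (_ *m _).
  by rewrite /paraconj tr_scalar_mx map_scalar_mx.
pose V' := paraconj T2 *m \adj (paraconj T1).
have Vr : V *m r%:M = q%:M *m V'.
  rewrite -mul_mx_adj mulmxA -(mulmxA _ T1) T12 !mulmxA mul_adj_mx.
  by rewrite -!mulmxA.
have cij i : exists c : 'I_m -> C, forall j, V i j = c j *: q.
  apply: (common_quotient (V' := V' i) q0 u2 rlow) => [j|].
    have /matrixP/(_ i j) := Vr; rewrite mul_mx_scalar mul_scalar_mx.
    by rewrite mxE [RHS]mxE mulrC.
  have /matrixP/(_ i i) := VV; rewrite [RHS]mxE eqxx mulr1n => <-.
  rewrite [RHS]mxE; apply: eq_bigr => j _.
  by rewrite [paraconj _ _ _]mxE [_^T _ _]mxE.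
have [c cP] := boolp.choice cij.
pose U := \matrix_(i, j) c i j.
have VU : V = q *: map_mx polyC U.
  by apply/matrixP => i j; rewrite cP !mxE mulrC mul_polyC.
exists U; last first.
  have : q *: T1 = q *: (T2 *m map_mx polyC U).
    by rewrite scalemxAr -VU mulmxA mul_mx_adj mul_scalar_mx.
  move=> /matrixP e; apply/matrixP => i j.
  by have := e i j; rewrite !mxE => /(mulfI q0).
apply/unitarymxP.
have qq0 : q * conjp q != 0 by rewrite mulf_neq0 ?map_poly_eq0.
apply/matrixP => i j; apply: polyC_inj; apply: (mulfI qq0).
have /matrixP/(_ i j) := VV; rewrite VU.
have -> : paraconj (q *: map_mx polyC U) = conjp q *: map_mx polyC (U^t* ).
  by apply/matrixP => a b; rewrite !mxE rmorphM /= map_polyC.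
rewrite -scalemxAl -scalemxAr scalerA -map_mxM [LHS]mxE [map_mx _ _ _ _]mxE => ->.
by rewrite -scalemx1 mxE; congr (_ * _); rewrite !mxE rmorphMn.
Qed.
End Uniqueness.

(** * From coefficient families to polynomial matrices *)

Section Family.
Variable R : rcfType.
Local Notation C := R[i].

Definition polymx m d (A : 'I_d.+1 -> 'M[C]_m) : 'M[{poly C}]_m :=
  \matrix_(i, j) \poly_(n < d.+1) A (inord n) i j.

Lemma evalmx_polymx m d (A : 'I_d.+1 -> 'M[C]_m) z :
  evalmx z (polymx A) = mxpoly_at A z.
Proof.
apply/matrixP => i j; rewrite !mxE /horner_eval horner_poly summxE.
by apply: eq_bigr => n _; rewrite inord_val mxE mulrC.
Qed.

Lemma polymx_coef m d (T : 'M[{poly C}]_m) :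
  (forall i j, size (T i j) <= d.+1)%N ->
  polymx (fun n : 'I_d.+1 => \matrix_(i, j) (T i j)`_n) = T.
Proof.
move=> Td; apply/matrixP => i j; rewrite mxE; apply/polyP => n.
rewrite coef_poly; case: ltnP => [nd|dn]; first by rewrite mxE inordK.
by rewrite nth_default// (leq_trans (Td i j)).
Qed.

Lemma evalmx_inj m (A B : 'M[{poly C}]_m) :
  (forall z, evalmx z A = evalmx z B) -> A = B.
Proof.
move=> AB; apply/matrixP => i j.
have dT : dense (fun _ : R => True).
  by move=> a b ab; exists ((a + b) / 2) => //; rewrite !midf_lt.
apply: (dense_poly_eq dT) => x _.
by have /matrixP/(_ i j) := AB x%:C; rewrite !mxE.
Qed.
End Family.

(** A nonempty open interval is not negligible. *)
Lemma ae_dense (R : realType) (D : R -> Prop) :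
  {ae @lebesgue_measure R, forall x, D x} -> dense D.
Proof.
move=> aeD a b ab; apply: contrapT => noD.
have ab_sub : (`]a, b[ `<=` ~` D)%classic.
  by move=> x /=; rewrite in_itv /= => xab Dx; apply: noD; exists x.
have ab_negl := negligibleS (mu := @lebesgue_measure R) ab_sub aeD.
have := @measure_negligible _ _ _ (@lebesgue_measure R) _
  (measurable_itv `]a, b[) ab_negl.
move=> /(eq_trans (esym (lebesgue_measure_itv `]a, b[))).
rewrite /= lte_fin ab -EFinD => /eqP.
by rewrite eqe subr_eq0 gt_eqF.
Qed.

Unset Implicit Arguments.

Theorem theorem2 (R : realType) (m N : nat) (hm : (1 <= m)%N)
    (C : 'I_(2 * N).+1 -> 'M[R[i]]_m)
    (hC : {ae @lebesgue_measure R, forall x : R, posdefmx (mxpoly_at C x%:C)}) :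
  (exists A : 'I_N.+1 -> 'M[R[i]]_m, spectral_factor C A) /\
  (forall A1 A2 : 'I_N.+1 -> 'M[R[i]]_m,
     spectral_factor C A1 -> spectral_factor C A2 ->
     exists2 U : 'M[R[i]]_m, U \is unitarymx &
       forall z : R[i], mxpoly_at A1 z = mxpoly_at A2 z *m U).
Proof.
split; last first.
  move=> A1 A2 [E1 u1 _] [E2 u2 _].
  have polymx_up (A : 'I_N.+1 -> 'M[R[i]]_m) :
      (forall z : R[i], 0 < complex.Im z -> \det (mxpoly_at A z) != 0) ->
      nonvanishing_upper (\det (polymx A)).
    by move=> uA z /uA; rewrite -det_evalmx evalmx_polymx.
  have [|U uU T12] := @factor_unique R m (polymx A1) (polymx A2) _
    (polymx_up A1 u1) (polymx_up A2 u2).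
    apply: evalmx_inj => z; rewrite !evalmxM !evalmx_paraconj !evalmx_polymx.
    by rewrite -[RHS]E2 -[LHS]E1.
  exists U => // z.
  have := congr1 (evalmx z) T12; rewrite evalmxM !evalmx_polymx => ->.
  by congr (_ *m _); apply/matrixP => i j; rewrite !mxE /horner_eval hornerC.
have dH : posdef_dense (polymx C).
  move=> a b ab; have [x xab pC] := ae_dense hC ab.
  by exists x; [exact: xab|rewrite evalmx_polymx].
have [T TE uT] := posdef_dense_factorable dH.
have sT i j : (size (T i j) <= N.+1)%N.
  apply: (size_sum_norm (p := T i)).
  have -> : \sum_j T i j * map_poly Num.conj (T i j) = polymx C i i.
    by rewrite TE mxE; apply: eq_bigr => l _; rewrite mxE [_^T _ _]mxE.
  by rewrite mxE addnn -mul2n size_poly.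
exists (fun n => \matrix_(i, j) (T i j)`_n).
set A := (fun n : 'I_N.+1 => _).
have AT z : mxpoly_at A z = evalmx z T by rewrite -evalmx_polymx polymx_coef.
split=> z.
- by rewrite /mxpoly_para !AT -evalmx_paraconj -evalmxM -TE evalmx_polymx.
- by rewrite AT det_evalmx; exact: uT.
- move=> z0; rewrite /mxpoly_para AT -evalmx_paraconj det_evalmx det_paraconj.
  rewrite horner_conjp conjC_eq0; apply: uT.
  by case: z z0 => x y /=; rewrite oppr_gt0.
Qed.
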